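(* Let $\varphi=\mathrm{Parity}(\{1,2,3\})$. There exists a finitely branching (countable) MDP $\mathcal M$ with a color function $\mathit{Col}:S\to\{1,2,3\}$ and an initial state $s_0$ such that (i) for every FR-strategy $\sigma$ we have $\mathcal P_{\mathcal M,s_0,\sigma}(\varphi)=0$, and (ii) there exists an HD-strategy $\sigma$ such that $\mathcal P_{\mathcal M,s_0,\sigma}(\varphi)=1$. Hence optimal (and even almost-surely winning) strategies and $\epsilon$-optimal strategies for $\mathrm{Parity}(\{1,2,3\})$ require infinite memory (i.e., cannot in general be chosen FR), even in finitely branching MDPs.
   Context: An MDP is $\mathcal M=\langle S,S_\Box,S_\circ,\longrightarrow,P\rangle$ where $S$ is a countable set of states partitioned into player states $S_\Box$ and random states $S_\circ$, $\longrightarrow\subseteq S\times S$ is a transition relation in which every state has at least one successor, and $P$ assigns to each random state a probability distribution over its successors. $\mathcal M$ is finitely branching if every state has finitely many successors, otherwise infinitely branching. A play is an infinite sequence $s_0s_1\cdots$ with $s_i\longrightarrow s_{i+1}$ for all $i$. A strategy is a function $\sigma:S^*S_\Box\to\mathcal D(S)$ assigning to each partial play ending in a player state $s$ a probability distribution over successors of $s$ (HR: general, history-dependent and randomized). Strategies are implemented by probabilistic transducers $(\mathsf M,\mathsf m_0,\pi_u,\pi_s)$ with countable memory $\mathsf M$, initial mode $\mathsf m_0$, randomized memory update $\pi_u:\mathsf M\times S\to\mathcal D(\mathsf M)$ and randomized successor choice $\pi_s:\mathsf M\times S_\Box\to\mathcal D(S)$ (choosing only successors of the current state); the induced strategy is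 $\sigma(s_0\cdots s_n)=\pi_s(s_n,\pi_u(s_0\cdots s_{n-1},\mathsf m_0))$ with $\pi_u$ extended to distributions and sequences in the natural way. A strategy is finite-memory (F) if some transducer with finite $\mathsf M$ induces it, deterministic (D) if $\pi_u,\pi_s$ can be taken to give Dirac distributions; FR = finite-memory randomized, HD = history-dependent deterministic. $\mathcal P_{\mathcal M,s_0,\sigma}$ is the standard probability measure on plays from $s_0$ induced by $\sigma$. For a color function $\mathit{Col}:S\to\mathcal C$ with $\mathcal C\subseteq\mathbb N$ finite, $\mathrm{Parity}(\mathcal C)$ is the set of plays in which the largest color occurring infinitely often is even. The value of $s$ is $\sup_\sigma\mathcal P_{\mathcal M,s,\sigma}(\varphi)$; $\sigma$ is $\epsilon$-optimal from $s$ if it achieves at least value minus $\epsilon$, optimal if $\epsilon=0$, almost-surely winning if it achieves probability $1$. *)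

(* Defs.v *)
From HB Require Import structures.
From mathcomp Require Import all_boot all_order all_algebra.
From mathcomp Require Import all_classical all_reals all_analysis.
Set Implicit Arguments. Unset Strict Implicit. Unset Printing Implicit Defensive.
Import Order.TTheory GRing.Theory Num.Theory.
Local Open Scope classical_set_scope.
Local Open Scope ring_scope.

(* player s = true  <->  s is a player state (S_Box);                  *)
(* player s = false <->  s is a random state (S_circ).                 *)
(* edge is the transition relation, P the transition probabilities     *)
(* (only meaningful at random states).                                 *)
Record mdp (R : realType) (S : countType) := MDP {
  player : pred S;
  edge : S -> S -> Prop;
  P : S -> S -> R;
  edge_total : forall s, exists t, edge s t;
  P_ge0 : forall s t, ~~ player s -> 0 <= P s t;
  P_supp : forall s t, ~~ player s -> P s t != 0 -> edge s t;
  P_sum1 : forall s, ~~ player s -> (\esum_(t in [set: S]) (P s t)%:E = 1)%E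
}.

Definition finitely_branching (R : realType) (S : countType) (M : mdp R S) :=
  forall s, finite_set [set t | edge M s t].

(* A (general) strategy: sigma h s t = probability of moving to t after *)
(* the partial play h ++ [:: s] (relevant only when s is a player state). *)
Definition strategy (R : realType) (S : countType) := seq S -> S -> S -> R.

Record fin_transducer (R : realType) (S : countType) (M : mdp R S)
    (Mem : finType) := FinTransducer {
  m0 : Mem;
  pi_u : Mem -> S -> Mem -> R;
  pi_s : Mem -> S -> S -> R;
  pi_u_ge0 : forall m s m', 0 <= pi_u m s m';
  pi_u_sum1 : forall m s, \sum_(m' : Mem) pi_u m s m' = 1;
  pi_s_ge0 : forall m s t, player M s -> 0 <= pi_s m s t;
  pi_s_supp : forall m s t, player M s -> pi_s m s t != 0 -> edge M s t;
  pi_s_sum1 : forall m s, player M s ->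
    (\esum_(t in [set: S]) (pi_s m s t)%:E = 1)%E
}.

Definition fin_mem_dist (R : realType) (S : countType) (M : mdp R S)
    (Mem : finType) (T : fin_transducer M Mem) (h : seq S) : Mem -> R :=
  foldl (fun (d : Mem -> R) (s : S) =>
           fun m' => \sum_(m : Mem) d m * pi_u T m s m')
        (fun m => (m == m0 T)%:R) h.

Definition fin_induced (R : realType) (S : countType) (M : mdp R S)
    (Mem : finType) (T : fin_transducer M Mem) : strategy R S :=
  fun h s t => \sum_(m : Mem) fin_mem_dist T h m * pi_s T m s t.

Definition FR_strategy (R : realType) (S : countType) (M : mdp R S)
    (sigma : strategy R S) :=
  exists (Mem : finType) (T : fin_transducer M Mem),
    forall h s t, player M s -> sigma h s t = fin_induced T h s t.

(* Deterministic transducers with countable memory (HD): the Dirac     *)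
(* distributions of pi_u, pi_s are given by their supports.             *)
Record det_transducer (R : realType) (S : countType) (M : mdp R S)
    (Mem : countType) := DetTransducer {
  dm0 : Mem;
  dpi_u : Mem -> S -> Mem;
  dpi_s : Mem -> S -> S;
  dpi_s_edge : forall m s, player M s -> edge M s (dpi_s m s)
}.

Definition det_induced (R : realType) (S : countType) (M : mdp R S)
    (Mem : countType) (T : det_transducer M Mem) : strategy R S :=
  fun h s t => (t == dpi_s T (foldl (dpi_u T) (dm0 T) h) s)%:R.

Definition HD_strategy (R : realType) (S : countType) (M : mdp R S)
    (sigma : strategy R S) :=
  exists (Mem : countType) (T : det_transducer M Mem),
    forall h s t, player M s -> sigma h s t = det_induced T h s t.

Definition step (R : realType) (S : countType) (M : mdp R S)
    (sigma : strategy R S) (h : seq S) (u t : S) : R :=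
  if player M u then sigma h u t else P M u t.

Fixpoint path_weight_from (R : realType) (S : countType) (M : mdp R S)
    (sigma : strategy R S) (h : seq S) (u : S) (rest : seq S) : R :=
  match rest with
  | [::] => 1
  | t :: r => step M sigma h u t * path_weight_from M sigma (rcons h u) t r
  end.

Definition cyl_weight (R : realType) (S : countType) (M : mdp R S)
    (s0 : S) (sigma : strategy R S) (w : seq S) : R :=
  match w with
  | [::] => 1
  | s :: r => (s == s0)%:R * path_weight_from M sigma [::] s r
  end.

Definition cyl (S : countType) (w : seq S) : set (nat -> S) :=
  [set rho | mkseq rho (size w) = w].

(* P_{M,s0,sigma}(A): Caratheodory outer measure generated by the       *)
(* cylinder probabilities; on measurable sets (e.g. parity sets) it     *)
(* coincides with the standard probability measure.                     *)
Definition Prob (R : realType) (S : countType) (M : mdp R S)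
    (s0 : S) (sigma : strategy R S) (A : set (nat -> S)) : \bar R :=
  ereal_inf [set (\sum_(n <oo) (cyl_weight M s0 sigma (c n))%:E)%E
            | c in [set c : nat -> seq S | A `<=` \bigcup_n cyl (c n)]].

Definition is_play (R : realType) (S : countType) (M : mdp R S)
    (rho : nat -> S) := forall i, edge M (rho i) (rho i.+1).

Definition inf_often (S : countType) (Col : S -> nat) (rho : nat -> S)
    (c : nat) := forall N, exists n, (N <= n)%N /\ Col (rho n) = c.

Definition Parity (R : realType) (S : countType) (M : mdp R S)
    (Col : S -> nat) : set (nat -> S) :=
  [set rho | is_play M rho /\
     exists c, inf_often Col rho c /\ ~~ odd c /\
       forall c', inf_often Col rho c' -> (c' <= c)%N].

(* Main.v *)
Require Import Defs.
From HB Require Import structures.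
From mathcomp Require Import all_boot all_order all_algebra.
From mathcomp Require Import all_classical all_reals all_analysis.
From mathcomp Require Import lra.
Set Implicit Arguments. Unset Strict Implicit. Unset Printing Implicit Defensive.
Import Order.TTheory GRing.Theory Num.Theory.
Import numFieldNormedType.Exports.
Local Open Scope classical_set_scope.
Local Open Scope ring_scope.

(* In the game, levels i = 0, 1, 2, ... are drawn again and again, independently
   and with probability 2^-(i+1). The player takes or declines each of them;
   taking level i shows color 2 and then, with probability 2^-i, color 3. All
   other states have color 1, so the player must take infinitely many levels while
   failing only finitely often.

   With infinite memory, the player declines every level below the number of
   levels already taken; Borel-Cantelli gives an almost sure win.

   With finitely many modes, let a_m and b_m be the probabilities that a draw
   started in mode m leads to a taken level, respectively to color 3. If a_m > 0
   then b_m > 0, hence b_m >= eta * a_m for some eta > 0 independent of m. Both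
   sides are linear in the distribution over modes, so the inequality holds after
   every history, and k levels in a row are taken without failure with probability
   at most (1 - eta)^k. There is only one decision per draw because the memory
   distribution of a transducer is not conditioned on the player's own random
   choices: if declining led on to further decisions in the same draw, survival
   probabilities would enter and linearity would be lost.

   Null sets are handled through covers by cylinders: the words at which a target
   is first hit give a cover whose weight is the hitting probability. *)

(** * Path weights and null sets of plays *)

Section PathMeasure.
Variables (R : realType) (S : countType) (M : mdp R S) (s0 dead : S).
Variables (sigma : strategy R S) (succ : S -> seq S).
(* [[:: dead]] has weight 0 and pads covers that need fewer cylinders. *)
Hypothesis dead_s0 : dead != s0.
Hypothesis succ_uniq : forall u, uniq (succ u).
Hypothesis step_ge0 : forall h u t, 0 <= step M sigma h u t.
Hypothesis step_supp :
  forall h u t, t \notin succ u -> step M sigma h u t = 0.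
Hypothesis step_sum1 : forall h u, \sum_(t <- succ u) step M sigma h u t = 1.

Local Notation pw := (path_weight_from M sigma).
Local Notation cw := (cyl_weight M s0 sigma).

(** Outer measure zero in terms of covers; the infimum itself is handled only in [Prob_null] and
    [Prob_full]. *)
Definition null (A : set (nat -> S)) := forall e : R, 0 < e ->
  exists c : nat -> seq S, A `<=` \bigcup_n cyl (c n) /\
    (\sum_(n <oo) (cw (c n))%:E <= e%:E)%E.

Lemma step_le1 h u t : step M sigma h u t <= 1.
Proof.
have [tu|/step_supp -> //] := boolP (t \in succ u).
rewrite -(step_sum1 h u) (big_rem t)//= lerDl.
by apply: sumr_ge0 => *.
Qed.

Lemma pw_ge0 v : forall h u, 0 <= pw h u v.
Proof. by elim: v => //= t v IH h u; rewrite mulr_ge0. Qed.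

Lemma pw_le1 v : forall h u, pw h u v <= 1.
Proof.
elim: v => //= t v IH h u.
by rewrite -[leRHS]mulr1 ler_pM ?step_le1 ?pw_ge0.
Qed.

Lemma cw_ge0 w : 0 <= cw w.
Proof. by case: w => //= s r; rewrite mulr_ge0 ?ler0n ?pw_ge0. Qed.

Lemma cw_ge0E w : (0 <= (cw w)%:E)%E.
Proof. by rewrite lee_fin cw_ge0. Qed.

Lemma cw_le1 w : cw w <= 1.
Proof.
case: w => //= s r; rewrite -[leRHS]mulr1 ler_pM ?ler0n ?pw_ge0 ?pw_le1//.
by case: (s == s0).
Qed.

Lemma cw_dead : cw [:: dead] = 0.
Proof. by rewrite /= (negbTE dead_s0) mul0r. Qed.

Lemma pw_rcons_cat w u v : forall h x,
  pw h x (rcons w u ++ v) = pw h x (rcons w u) * pw (h ++ x :: w) u v.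
Proof.
elim: w => [|y w IH] h x /=.
  by rewrite mulr1 -cats1.
by rewrite IH mulrA -cats1 -catA.
Qed.

Lemma cw_rcons_cat h u v : cw (rcons h u ++ v) = cw (rcons h u) * pw h u v.
Proof.
case: h => [|x h] /=; first by rewrite mulr1.
by rewrite pw_rcons_cat mulrA.
Qed.

Lemma cw_sum_dead : (\sum_(n <oo) (cw [:: dead])%:E = 0)%E.
Proof. by rewrite cw_dead; apply: eseries0. Qed.

Lemma null_sub A B : A `<=` B -> null B -> null A.
Proof.
move=> AB nB e e0; have [c [Bc ce]] := nB e e0.
by exists c; split=> //; apply: subset_trans Bc.
Qed.

Lemma null_set0 : null set0.
Proof.
move=> e e0; exists (fun _ => [:: dead]); split; first exact: sub0set.
by rewrite cw_sum_dead lee_fin ltW.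
Qed.

(** The [n]-th set gets a cover of weight at most [e / 2^(n+1)]; a bijection of [nat] with
    [nat * nat] merges the covers. *)
Lemma null_bigcup (F : nat -> set (nat -> S)) :
  (forall n, null (F n)) -> null (\bigcup_n F n).
Proof.
move=> nF e e0.
pose P n (c : nat -> seq S) := F n `<=` \bigcup_k cyl (c k) /\
  (\sum_(k <oo) (cw (c k))%:E <= (e / (2 ^ n.+1)%:R)%:E)%E.
have [G PG] : {G : nat -> nat -> seq S & forall n, P n (G n)}.
  apply: (@choice _ _ P) => n; apply: nF.
  by rewrite divr_gt0// ltr0n expn_gt0.
have /card_esym/ppcard_eqP[f] := card_nat2.
exists (uncurry G \o f); split.
  move=> t [i _ /((PG i).1) [j _ Gij]].
  by exists (f^-1%FUN (i, j)) => //=; rewrite invK ?inE.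
rewrite nneseries_esumT; last by move=> n; apply: cw_ge0E.
rewrite -(@reindex_esum R _ _ setT setT f (fun k => (cw (uncurry G k))%:E));
  last exact: 'bij_f.
have -> : \esum_(k in [set: nat * nat]) (cw (uncurry G k))%:E =
    \esum_(i in [set: nat]) \esum_(j in [set: nat]) (cw (G i j))%:E.
  rewrite esum_esum; last by move=> *; apply: cw_ge0E.
  rewrite (_ : _ `*`` _ = setT); last by apply/seteqP; split.
  by apply: eq_esum => -[].
rewrite -nneseries_esumT; last first.
  by move=> i; apply: esum_ge0 => j _; apply: cw_ge0E.
apply: le_trans (epsilon_trick0 predT (ltW e0)).
apply: lee_nneseries => [i _ _|i _].
  by apply: esum_ge0 => j _; apply: cw_ge0E.
rewrite -nneseries_esumT; last by move=> j; apply: cw_ge0E.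
exact: (PG i).2.
Qed.

Lemma null_ex (I : countType) (F : I -> set (nat -> S)) :
  (forall i, null (F i)) -> null [set rho | exists i, F i rho].
Proof.
move=> nF; pose G n := if unpickle n is Some i then F i else set0.
apply: (@null_sub _ (\bigcup_n G n)).
  by move=> rho [i Fi]; exists (pickle i) => //; rewrite /G pickleK.
apply: null_bigcup => n; rewrite /G; case: unpickle => [i|] //.
exact: null_set0.
Qed.

Lemma null_setU A B : null A -> null B -> null (A `|` B).
Proof.
move=> nA nB.
apply: (@null_sub _ [set rho | exists b : bool, (if b then A else B) rho]).
  by move=> rho [?|?]; [exists true|exists false].
by apply: null_ex => -[].
Qed.

Lemma null_cyl w : cw w = 0 -> null (cyl w).
Proof.
move=> w0 e e0; exists (fun=> w); split; first by move=> rho; exists 0%N.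
by rewrite w0 eseries0 ?lee_fin ?ltW.
Qed.

Lemma mkseqS_rcons (rho : nat -> S) n : mkseq rho n.+1 = rcons (mkseq rho n) (rho n).
Proof. by rewrite /mkseq -addn1 iotaD map_cat cats1. Qed.

(** Each such sequence has a finite prefix of weight 0, and there are only countably many words. *)
Lemma null_step0 : null [set rho | ~ (rho 0%N = s0 /\
  forall n, step M sigma (mkseq rho n) (rho n) (rho n.+1) != 0)].
Proof.
apply: (@null_sub _ [set rho | exists w : {w : seq S | cw w == 0}, cyl (val w) rho]);
  last by apply: null_ex => -[w /= /eqP]; exact: null_cyl.
move=> rho /= /not_andP [r0|/existsNP [n /negP/negPn/eqP sn]].
- have w0 : cw [:: rho 0%N] == 0 by rewrite /= (negbTE (introN eqP r0)) mul0r.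
  by exists (exist (fun w => cw w == 0) _ w0).
- have w0 : cw (mkseq rho n.+2) == 0.
    by rewrite !mkseqS_rcons -[rcons (rcons _ _) _]cats1 cw_rcons_cat /= sn mul0r mulr0.
  exists (exist (fun w => cw w == 0) _ w0).
  by change (mkseq rho (size (mkseq rho n.+2)) = mkseq rho n.+2); rewrite size_mkseq.
Qed.

(** * Hitting probabilities within a bounded number of steps *)

Fixpoint hit (T : seq S -> S -> bool) L h u : R :=
  if T h u then 1 else
  if L is L'.+1 then \sum_(t <- succ u) step M sigma h u t * hit T L' (rcons h u) t
  else 0.

Fixpoint first_hit (T : seq S -> S -> bool) h u v :=
  if v is t :: v' then ~~ T h u && first_hit T (rcons h u) t v' else T h u.

(** Optional stopping: [V] is a supermartingale until [T] is hit, and is at least 1 there. The drift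
    is only required under [I], which steps of positive probability preserve. *)
Lemma hit_le (T : seq S -> S -> bool) (I : seq S -> S -> Prop) (V : seq S -> S -> R) :
  (forall h u t, I h u -> step M sigma h u t != 0 -> I (rcons h u) t) ->
  (forall h u, 0 <= V h u) -> (forall h u, T h u -> 1 <= V h u) ->
  (forall h u, I h u -> ~~ T h u ->
    \sum_(t <- succ u) step M sigma h u t * V (rcons h u) t <= V h u) ->
  forall L h u, I h u -> hit T L h u <= V h u.
Proof.
move=> IS V0 V1 VS; elim=> [|L IH] h u Ihu /=; case: ifPn => Thu //; first exact: V1.
- exact: V1.
- apply: le_trans (VS h u Ihu Thu); apply: ler_sum => t _.
  have [->|st] := eqVneq (step M sigma h u t) 0; first by rewrite !mul0r.
  by rewrite ler_wpM2l// IH//; apply: IS.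
Qed.

Lemma hit_le1 (T : seq S -> S -> bool) L h u : hit T L h u <= 1.
Proof.
apply: (@hit_le T (fun _ _ => True) (fun _ _ => 1)) => // {}h {}u _ _.
by under eq_bigr do rewrite mulr1; rewrite step_sum1.
Qed.

(** First-hit words are prefix-free, so their cylinders are disjoint. The induction on [L] groups
    the words by first letter, [tl t] being the tails of those that start with [t]. *)
Lemma sum_first_hit (T : seq S -> S -> bool) L : forall h u (X : seq (seq S)), uniq X ->
  all (fun v => size v <= L)%N X ->
  \sum_(v <- X | first_hit T h u v) pw h u v <= hit T L h u.
Proof.
have sum_nil h u (X : seq (seq S)) : T h u -> uniq X ->
    \sum_(v <- X | first_hit T h u v) pw h u v <= 1.
  move=> Thu uX; apply: (@le_trans _ _ (\sum_(v <- X | v == [::]) 1)).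
    rewrite [leLHS]big_mkcond [leRHS]big_mkcond /=; apply: ler_sum => -[|t v] _ /=.
      by case: ifP.
    by rewrite Thu.
  rewrite big_const_seq iter_addr_0 -[leRHS](mulr1n 1) ler_nat.
  by rewrite count_uniq_mem// leq_b1.
elim: L => [|L IH] h u X uX sX; have [Thu|Thu] := boolP (T h u).
- by rewrite /= Thu; apply: sum_nil.
- rewrite /= (negbTE Thu) big_seq_cond big1// => -[|t v] /=.
    by rewrite (negbTE Thu) andbF.
  by move=> /andP[/(allP sX)].
- by rewrite /= Thu; apply: sum_nil.
rewrite /= (negbTE Thu).
pose tl t := [seq behead v | v <- X & ohead v == Some t].
have split_v v : (if first_hit T h u v then pw h u v else 0) =
    \sum_(t <- succ u | ohead v == Some t)
      (if first_hit T (rcons h u) t (behead v)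
       then step M sigma h u t * pw (rcons h u) t (behead v) else 0).
  case: v => [|t v] /=; first by rewrite (negbTE Thu) big_pred0.
  rewrite Thu /= (eq_bigl (pred1 t)); last by move=> s; rewrite eqE /= eq_sym.
  have [tu|tu] := boolP (t \in succ u).
    by rewrite -big_filter filter_pred1_uniq// big_seq1.
  by rewrite big1 => [|s /eqP ->]; rewrite step_supp// mul0r if_same.
rewrite big_mkcond /= (eq_bigr _ (fun v _ => split_v v)) (exchange_big_dep xpredT)//=.
apply: ler_sum => t _.
have -> : \sum_(v <- X | ohead v == Some t)
      (if first_hit T (rcons h u) t (behead v)
       then step M sigma h u t * pw (rcons h u) t (behead v) else 0) =
    step M sigma h u t * \sum_(v <- tl t | first_hit T (rcons h u) t v)
      pw (rcons h u) t v.
  rewrite /tl big_map big_filter_cond mulr_sumr big_mkcondr /=.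
  by apply: eq_bigr => v _; case: ifP.
rewrite ler_wpM2l//; apply: IH.
  rewrite map_inj_in_uniq ?filter_uniq// => -[|a v] [|b w]; rewrite !mem_filter //=.
  by move=> /andP[/eqP[->] _] /andP[/eqP[->] _] ->.
apply/allP => v /mapP[w]; rewrite mem_filter => /andP[wt /(allP sX)] sw ->.
by case: w sw wt.
Qed.

Lemma first_hit_mkseq (T : seq S -> S -> bool) rho n : forall h u,
  mkseq rho (size h).+1 = rcons h u ->
  (forall m, (m < n)%N -> ~~ T (mkseq rho (size h + m)) (rho (size h + m)%N)) ->
  T (mkseq rho (size h + n)) (rho (size h + n)%N) ->
  first_hit T h u (mkseq (fun i => rho ((size h).+1 + i)%N) n).
Proof.
elim: n => [|n IH] h u hu nT yT.
  move: hu; rewrite mkseqS_rcons => /rcons_inj[hh uu].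
  by move: yT; rewrite addn0 hh uu.
have [hh uu] : mkseq rho (size h) = h /\ rho (size h) = u.
  by move: hu; rewrite mkseqS_rcons => /rcons_inj[].
have -> : mkseq (fun i => rho ((size h).+1 + i)%N) n.+1 =
    rho (size h).+1 :: mkseq (fun i => rho ((size (rcons h u)).+1 + i)%N) n.
  rewrite /mkseq /= addn0 size_rcons; congr cons.
  rewrite (iotaDl 1 0) -map_comp; apply: eq_map => i /=.
  by rewrite addnA addn1.
apply/andP; split.
  by have := nT 0%N isT; rewrite addn0 hh uu.
apply: IH; rewrite ?size_rcons.
- by rewrite mkseqS_rcons hu.
- by move=> m mn; rewrite addSnnS; apply: nT.
- by rewrite addSnnS.
Qed.

(** A partial sum of the cover involves words of bounded length only, so a bound on [hit] uniform in
    [L] bounds the whole series. *)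
Lemma null_hit A h u :
  (forall e : R, 0 < e -> exists T, (forall L, hit T L h u <= e) /\
    A `<=` [set rho | mkseq rho (size h).+1 = rcons h u /\
      exists n, T (mkseq rho (size h + n)) (rho (size h + n)%N)]) ->
  null A.
Proof.
move=> hA e e0; have [T [hT AT]] := hA e e0.
(* [pickle_inv] yields every word exactly once, so no weight is counted twice. *)
pose c k := if @pickle_inv (seq S) k is Some v then
  if first_hit T h u v then rcons h u ++ v else [:: dead] else [:: dead].
exists c; split.
  move=> rho /AT /= [hu exT]; have [n Tn minn] := ex_minnP exT.
  exists (pickle (mkseq (fun i => rho ((size h).+1 + i)%N) n)) => //.
  rewrite /c pickleK_inv first_hit_mkseq//; last first.
    by move=> m mn; apply: contraL mn => /minn; rewrite leqNgt.
  rewrite /cyl /= size_cat size_mkseq size_rcons -hu /mkseq iotaD map_cat.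
  congr (_ ++ _); rewrite add0n -[in LHS](addn0 (size h).+1) iotaDl -map_comp.
  exact: eq_map.
apply: lime_le; first by apply: is_cvg_nneseries => *; apply: cw_ge0E.
apply: nearW => K; rewrite sumEFin lee_fin.
pose X := pmap (@pickle_inv (seq S)) (iota 0 K).
apply: (@le_trans _ _ (\sum_(v <- X | first_hit T h u v) pw h u v)).
  rewrite /X /index_iota subn0; elim: (iota 0 K) => [|k s IH] /=.
    by rewrite !big_nil.
  rewrite big_cons {1}/c; case: pickle_inv => [v|] /=; last first.
    by rewrite (negbTE dead_s0) mul0r add0r.
  rewrite big_cons; case: ifP => _; last by rewrite cw_dead add0r.
  rewrite lerD// cw_rcons_cat.
  by rewrite -[leRHS]mul1r ler_wpM2r ?pw_ge0 ?cw_le1.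
apply: (le_trans _ (hT (\max_(v <- X) size v)%N)).
apply: sum_first_hit.
  by apply: (pmap_uniq (@pickle_invK _)); exact: iota_uniq.
by apply/allP => v vX; exact: leq_bigmax_seq.
Qed.

(** * Covers of the whole space, and the values 0 and 1 of [Prob] *)

(* The probability of the cylinder of [w] conditioned on the prefix [rcons h u]. *)
Definition cond_weight h u w : R :=
  if prefix w (rcons h u) then 1
  else if prefix (rcons h u) w then pw h u (drop (size h).+1 w) else 0.

Lemma cond_weight_ge0 h u w : 0 <= cond_weight h u w.
Proof. by rewrite /cond_weight; do 2?case: ifP => // _; rewrite ?pw_ge0. Qed.

Lemma prefix_rconsE (w s : seq S) t :
  prefix w (rcons s t) = prefix w s || (w == rcons s t).
Proof.
apply/idP/orP => [/prefixP[r]|[/prefixP[r ->]|/eqP ->]].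
- case/lastP: r => [|r x]; first by rewrite cats0 => ->; right.
  by rewrite -rcons_cat => /rcons_inj[-> _]; left; apply: prefix_prefix.
- by rewrite rcons_cat prefix_prefix.
- exact: prefix_refl.
Qed.

(** Law of total probability over the next state; it makes the total conditional weight of a cover a
    martingale. *)
Lemma cond_weight_step h u w : cond_weight h u w =
  \sum_(t <- succ u) step M sigma h u t * cond_weight (rcons h u) t w.
Proof.
rewrite {1}/cond_weight; have [wh|wh] := boolP (prefix w (rcons h u)).
  rewrite -(step_sum1 h u); apply: eq_bigr => t _.
  by rewrite /cond_weight prefix_rconsE wh mulr1.
have [hw|hw] := boolP (prefix (rcons h u) w); last first.
  rewrite big1// => t _; rewrite /cond_weight prefix_rconsE (negbTE wh) /=.
  have [wE|_] := eqVneq; first by rewrite wE prefix_rcons in hw.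
  case: ifP; last by rewrite mulr0.
  by move=> /(prefix_trans (prefix_rcons _ _)); rewrite (negbTE hw).
case/prefixP: hw => -[wE|t0 v wE]; first by rewrite wE cats0 prefix_refl in wh.
have cwE t : cond_weight (rcons h u) t w =
    if t == t0 then pw (rcons h u) t0 v else 0.
  have dE : drop (size (rcons h u)).+1 w = v.
    by rewrite wE -cat_rcons drop_size_cat// !size_rcons.
  rewrite /cond_weight dE wE -[rcons (rcons h u) t]cats1 !prefix_catr// !eqxx /=.
  rewrite eq_sym.
  by case: (eqVneq t t0) => [->|_]; case: v {wE dE} => //= *; rewrite ?prefix0s.
have -> /= : drop (size h).+1 w = t0 :: v.
  by rewrite wE -[(size h).+1](size_rcons h u) drop_size_cat.
under eq_bigr do rewrite cwE.
have [tu|tu] := boolP (t0 \in succ u).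
  rewrite (bigD1_seq t0)//= eqxx big1 ?addr0// => t /negbTE ->.
  by rewrite mulr0.
rewrite step_supp// mul0r big_seq_cond big1// => t /andP[tu' _].
by case: eqP => [tE|_]; [rewrite -tE tu' in tu|rewrite mulr0].
Qed.

(* If the total weight were below 1, some successor would always keep the
   conditional weight below 1, and the play so chosen would avoid every cylinder. *)
Lemma full_cover c : setT `<=` \bigcup_n cyl (c n) ->
  (1 <= \sum_(n <oo) (cw (c n))%:E)%E.
Proof.
move=> cT; rewrite leNgt; apply/negP => c1.
pose Q h u := (\sum_(n <oo) (cond_weight h u (c n))%:E)%E.
have Q0 : (Q [::] s0 < 1)%E.
  apply: le_lt_trans c1; apply: lee_nneseries => n *.
    by rewrite lee_fin cond_weight_ge0.
  rewrite lee_fin /cond_weight /=; case: (c n) => //= x w; rewrite drop0 eq_sym.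
  by case: eqP => [->|_] /=; rewrite ?mul0r// mul1r prefix0s; case: w.
have QS h u : exists t, (Q h u < 1)%E -> (Q (rcons h u) t < 1)%E.
  apply: contrapT => /forallNP nt.
  have Qt t : (1 <= Q (rcons h u) t)%E.
    by rewrite leNgt; apply/negP => ?; apply: (nt t).
  have /not_implyP[+ _] := nt u; apply/negP; rewrite -leNgt.
  have -> : Q h u = (\sum_(t <- succ u) (step M sigma h u t)%:E * Q (rcons h u) t)%E.
    rewrite /Q; under eq_eseriesr => n _ do rewrite cond_weight_step -sumEFin.
    rewrite nneseries_sum; last first.
      by move=> *; rewrite lee_fin mulr_ge0// cond_weight_ge0.
    apply: eq_bigr => t _; under eq_eseriesr => n _ do rewrite EFinM.
    by rewrite nneseriesZl// => n _; rewrite lee_fin cond_weight_ge0.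
  rewrite -(step_sum1 h u) -sumEFin; apply: lee_sum => t _.
  by rewrite -[leLHS]mule1 lee_wpmul2l// lee_fin.
have [nxt nxtP] := choice (fun hu : seq S * S => QS hu.1 hu.2).
pose F (hu : seq S * S) := (rcons hu.1 hu.2, nxt hu).
pose p n := iter n F ([::], s0); pose rho n := (p n).2.
have pE n : (p n).1 = mkseq rho n.
  by elim: n => // n IH; rewrite mkseqS_rcons -IH.
have pQ n : (Q (p n).1 (p n).2 < 1)%E.
  by elim: n => // n IH; apply: nxtP.
have [n _] := cT rho I; rewrite /cyl /= => cn.
have := pQ (size (c n)); apply/negP; rewrite -leNgt.
apply: le_trans (nneseries_lim_ge n.+1 _); last first.
  by move=> *; rewrite lee_fin cond_weight_ge0.
rewrite sumEFin lee_fin big_nat_recr//= -[leLHS]add0r lerD//.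
  by apply: sumr_ge0 => *; exact: cond_weight_ge0.
by rewrite /cond_weight pE cn prefix_rcons.
Qed.

Lemma Prob_null A : null A -> Prob M s0 sigma A = 0%E.
Proof.
move=> nA; apply/eqP; rewrite eq_le; apply/andP; split; last first.
  apply: le_ereal_inf_tmp => _ [c _ <-]; apply: nneseries_ge0 => *; exact: cw_ge0E.
apply/lee_addgt0Pr => e e0; rewrite add0e.
have [c [Ac ce]] := nA e e0.
by apply: le_trans ce; apply: ereal_inf_lbound; exists c.
Qed.

(** The empty word covers everything with weight 1. Conversely, a cover of [A] interleaved with a
    cover of the complement of weight at most [e] covers all sequences, hence weighs at least 1. *)
Lemma Prob_full A : null (~` A) -> Prob M s0 sigma A = 1%E.
Proof.
move=> nA; apply/eqP; rewrite eq_le; apply/andP; split.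
  apply: ereal_inf_lbound.
  exists (fun n => if n is 0%N then [::] else [:: dead]).
    by move=> rho _; exists 0%N.
  rewrite nneseries_recl//; last by move=> *; apply: cw_ge0E.
  by rewrite eseries0 ?adde0// => -[|n] // *; rewrite cw_dead.
apply: le_ereal_inf_tmp => _ [c Ac <-]; apply/lee_addgt0Pr => e e0.
have [c' [Ac' ce']] := nA e e0.
pose d n := if odd n then c' n./2 else c n./2.
apply: (@le_trans _ _ (\sum_(n <oo) (cw (d n))%:E)%E).
  apply: full_cover => rho _; have [/Ac|/Ac'] := pselect (A rho).
    by move=> [n _ cn]; exists n.*2 => //; rewrite /d odd_double doubleK.
  by move=> [n _ cn]; exists n.*2.+1 => //; rewrite /d /= odd_double /= uphalf_double.
apply: lime_le; first by apply: is_cvg_nneseries => *; apply: cw_ge0E.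
apply: nearW => N.
have dN : (\sum_(0 <= n < N.*2) (cw (d n))%:E =
    \sum_(0 <= n < N) (cw (c n))%:E + \sum_(0 <= n < N) (cw (c' n))%:E)%E.
  elim: N => [|N IH]; first by rewrite !big_geq// adde0.
  rewrite doubleS !big_nat_recr//= IH /d /= odd_double /= uphalf_double doubleK.
  by rewrite -!addeA; congr (_ + _)%E; rewrite addeCA.
apply: (@le_trans _ _ (\sum_(0 <= n < N.*2) (cw (d n))%:E)%E).
  rewrite !sumEFin lee_fin -addnn (@big_cat_nat _ _ _ N _ _ _ _ _ (leq_addr _ _))//=.
  rewrite lerDl.
  by apply: sumr_ge0 => *; apply: cw_ge0.
rewrite dN; apply: leeD.
  by apply: nneseries_lim_ge => *; apply: cw_ge0E.
by apply: le_trans ce'; apply: nneseries_lim_ge => *; apply: cw_ge0E.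
Qed.

End PathMeasure.

Lemma exists_expr_le (R : realType) (x e : R) : 0 <= x < 1 -> 0 < e ->
  exists k, x ^+ k <= e.
Proof.
move=> /andP[x0 x1] e0.
have /cvg_expr/cvgrPdist_lt xc : `|x| < 1 by rewrite ger0_norm.
have [k _ /(_ k (leqnn k))] := xc e e0.
by rewrite sub0r normrN => /ltW; exists k; rewrite (le_trans (ler_norm _)).
Qed.

(** * The game *)

(* In [Draw i] a fair coin either moves on to [Draw i.+1] or offers level [i] to
   the player, who takes it (moving to [Taken i]) or goes back to [Draw 0].
   [Taken i] leads to [Bad] with probability [2^-i]. *)
Inductive state := Draw of nat | Offer of nat | Taken of nat | Bad.

Definition state_code s : nat * nat :=
  match s with
  | Draw i => (0, i) | Offer i => (1, i) | Taken i => (2, i) | Bad => (3, 0)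
  end%N.

Definition state_decode (c : nat * nat) :=
  match c with
  | (0, i) => Draw i | (1, i) => Offer i | (2, i) => Taken i | _ => Bad
  end%N.

Lemma state_codeK : cancel state_code state_decode.
Proof. by case. Qed.

HB.instance Definition _ := Countable.copy state (can_type state_codeK).

Definition succ s :=
  match s with
  | Draw i => [:: Offer i; Draw i.+1]
  | Offer i => [:: Taken i; Draw 0]
  | Taken _ => [:: Bad; Draw 0]
  | Bad => [:: Draw 0]
  end.

Definition is_offer s := if s is Offer _ then true else false.
Definition is_taken s := if s is Taken _ then true else false.
Definition is_bad s := if s is Bad then true else false.

Definition color s : nat :=
  match s with Taken _ => 2 | Bad => 3 | _ => 1 end.

Lemma succ_uniq s : uniq (succ s).
Proof. by case: s => // i; rewrite /= inE andbT. Qed.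

Section Game.
Variable R : realType.

Definition half (i : nat) : R := 2^-1 ^+ i.

Lemma half_gt0 i : 0 < half i.
Proof. by rewrite exprn_gt0// invr_gt0. Qed.

Lemma half_ge0 i : 0 <= half i.
Proof. exact/ltW/half_gt0. Qed.

Lemma halfS i : half i.+1 = half i / 2.
Proof. by rewrite /half exprSr. Qed.

Lemma half_le i j : (i <= j)%N -> half j <= half i.
Proof.
move=> /subnKC <-; elim: (j - i)%N => [|d IH]; first by rewrite addn0.
by rewrite addnS halfS; have := half_ge0 (i + d); lra.
Qed.

Lemma half_le1 i : half i <= 1.
Proof. exact: (@half_le 0). Qed.

Definition prob (s t : state) : R :=
  match s with
  | Draw i => (t == Offer i)%:R / 2 + (t == Draw i.+1)%:R / 2
  | Taken i => (t == Bad)%:R * half i + (t == Draw 0)%:R * (1 - half i)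
  | _ => (t == Draw 0)%:R
  end.

Lemma prob_ge0 s t : 0 <= prob s t.
Proof.
case: s => [i|i|i|] /=; rewrite ?ler0n ?addr_ge0 ?divr_ge0 ?mulr_ge0 ?ler0n ?half_ge0//.
by have := half_le1 i; lra.
Qed.

Lemma prob_supp s t : ~~ is_offer s -> t \notin succ s -> prob s t = 0.
Proof.
case: s => [i|i|i|] //= _; rewrite !inE ?negb_or.
- by move=> /andP[/negbTE-> /negbTE->]; rewrite !mul0r addr0.
- by move=> /andP[/negbTE-> /negbTE->]; rewrite !mul0r addr0.
- by move=> /negbTE->.
Qed.

Lemma prob_sum1 s : ~~ is_offer s -> \sum_(t <- succ s) prob s t = 1.
Proof.
case: s => [i|i|i|] //= _; rewrite !big_cons big_nil /= ?eqxx /=.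
- by rewrite !mul0r; lra.
- by rewrite !mul0r !mul1r; lra.
- by rewrite addr0.
Qed.

Lemma esum_seq (T : choiceType) (r : seq T) (f : T -> R) : uniq r ->
  (forall t, 0 <= f t) -> (forall t, t \notin r -> f t = 0) ->
  (\esum_(t in [set: T]) (f t)%:E = (\sum_(t <- r) f t)%:E)%E.
Proof.
move=> ur f0 fr.
have -> : (\esum_(t in [set: T]) (f t)%:E = \esum_(t in [set` r]) (f t)%:E)%E.
  rewrite [RHS]esum_mkcond; apply: eq_esum => t _.
  by rewrite mem_setE; case: ifPn => // /fr ->.
rewrite esum_fset; [|exact: finite_seq|by move=> t _; rewrite lee_fin].
by rewrite -(fsbig_seq _ _ ur) sumEFin.
Qed.

Lemma succ_total s : exists t, t \in succ s.
Proof. by case: s => [i|i|i|]; eexists; apply: mem_head. Qed.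

Definition game : mdp R state.
Proof.
apply: (@MDP R state is_offer (fun s t => t \in succ s) prob succ_total).
- by move=> s t _; exact: prob_ge0.
- by move=> s t ns; apply: contraNT => /(prob_supp ns) ->.
- move=> s ns; rewrite (esum_seq (succ_uniq s)) ?prob_sum1//.
  + by move=> t; exact: prob_ge0.
  + by move=> t; exact: prob_supp.
Defined.

Lemma game_finitely_branching : finitely_branching game.
Proof. by move=> s; exact: finite_seq. Qed.

Lemma count_mkseq_unbounded (p : pred state) (rho : nat -> state) :
  (forall N, exists n, (N <= n)%N /\ p (rho n)) ->
  forall k, exists n, (k <= count p (mkseq rho n))%N.
Proof.
move=> prho; elim=> [|k [n kn]]; first by exists 0%N.
have [m [nm pm]] := prho n; exists m.+1.
rewrite mkseqS_rcons -cats1 count_cat /= pm addn0 addn1 ltnS (leq_trans kn)//.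
by rewrite /mkseq -(subnKC nm) iotaD map_cat count_cat leq_addr.
Qed.

Lemma drop_mkseq (rho : nat -> state) N n :
  drop N (mkseq rho (N + n)) = mkseq (fun i => rho (N + i)%N) n.
Proof.
by rewrite /mkseq -map_drop drop_iota add0n addKn -{1}[N]addn0 iotaDl -map_comp.
Qed.

End Game.

(** * One-step expectations in the game *)

Section Steps.
Variables (R : realType) (sigma : strategy R state).
Local Notation stp := (step (game R) sigma).
Hypothesis sigma_ge0 : forall h l t, 0 <= sigma h (Offer l) t.
Hypothesis sigma_supp :
  forall h l t, t \notin succ (Offer l) -> sigma h (Offer l) t = 0.
Hypothesis sigma_sum1 :
  forall h l, sigma h (Offer l) (Taken l) + sigma h (Offer l) (Draw 0) = 1.

Lemma step_sum_Draw h i f :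
  \sum_(t <- succ (Draw i)) stp h (Draw i) t * f t = (f (Offer i) + f (Draw i.+1)) / 2.
Proof. by rewrite !big_cons big_nil /step /= !eqxx /=; lra. Qed.

Lemma step_sum_Offer h i f :
  \sum_(t <- succ (Offer i)) stp h (Offer i) t * f t =
  sigma h (Offer i) (Taken i) * f (Taken i) + sigma h (Offer i) (Draw 0) * f (Draw 0).
Proof. by rewrite !big_cons big_nil addr0. Qed.

Lemma step_sum_Taken h i f :
  \sum_(t <- succ (Taken i)) stp h (Taken i) t * f t =
  half R i * f Bad + (1 - half R i) * f (Draw 0).
Proof. by rewrite !big_cons big_nil /step /= ; lra. Qed.

Lemma step_sum_Bad h f : \sum_(t <- succ Bad) stp h Bad t * f t = f (Draw 0).
Proof. by rewrite !big_cons big_nil /step /= mul1r addr0. Qed.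

Lemma game_step_ge0 h u t : 0 <= stp h u t.
Proof.
rewrite /step; case: u => [i|i|i|]; last exact: (@prob_ge0 R Bad).
- exact: (@prob_ge0 R (Draw i)).
- exact: sigma_ge0.
- exact: (@prob_ge0 R (Taken i)).
Qed.

Lemma game_step_supp h u t : t \notin succ u -> stp h u t = 0.
Proof.
rewrite /step; case: u => [i|i|i|] tu /=; last exact: (@prob_supp R Bad).
- exact: (@prob_supp R (Draw i)).
- exact: sigma_supp.
- exact: (@prob_supp R (Taken i)).
Qed.

Lemma game_step_sum1 h u : \sum_(t <- succ u) stp h u t = 1.
Proof.
case: u => [i|i|i|]; first exact: (@prob_sum1 R (Draw i)).
- by rewrite !big_cons big_nil addr0 sigma_sum1.
- exact: (@prob_sum1 R (Taken i)).
- exact: (@prob_sum1 R Bad).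
Qed.
End Steps.

(** * A uniform ratio between failing and taking a level *)

Section Tilt.
Variables (R : realType) (Mem : finType) (A : nat -> Mem -> R).
Hypothesis A_ge0 : forall l m, 0 <= A l m.
Hypothesis A_le1 : forall l m, A l m <= 1.

Lemma sum_halfS L : \sum_(l < L) half R l.+1 = 1 - half R L.
Proof.
elim: L => [|L IH]; first by rewrite big_ord0 subrr.
by rewrite big_ord_recr /= IH halfS; lra.
Qed.

(** The sum is [x] times the probability of taking a level, minus that of failing, over the levels
    below [L]. At the least level [k] with [A k m] nonzero the term is at most [- eta]; the others
    add up to at most [x]. Allowing all [x] up to [eta] prepares a minimum over the modes. *)
Lemma tilt_mode m : exists eta : R, [/\ 0 < eta, eta <= 1 &
  forall x L, 0 <= x <= eta ->
    \sum_(l < L) half R l.+1 * (A l m * (x - half R l)) <= 0].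
Proof.
have [[l0 Al0]|A0] := pselect (exists l, A l m != 0); last first.
  exists 1; split=> // x L _; rewrite big1// => l _.
  have [->|Al] := eqVneq (A l m) 0; first by rewrite mul0r mulr0.
  by case: A0; exists l.
have [k [kA kmin]] : exists k, A k m != 0 /\ forall l, A l m != 0 -> (k <= l)%N.
  by case: (ex_minnP (ex_intro (fun l => A l m != 0) l0 Al0)) => k *; exists k.
have Ap : 0 < A k m by rewrite lt_def kA A_ge0.
pose eta := half R k.+1 * (A k m * half R k.+1).
have h1 := half_gt0 R k.+1; have h2 := half_gt0 R k.
have hS := halfS R k; have h3 := half_le1 R k; have Ak1 := A_le1 k m.
exists eta; split; rewrite /eta.
- by rewrite !mulr_gt0.
- by rewrite mulr_ile1 ?mulr_ge0 ?mulr_ile1 ?half_ge0 ?half_le1.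
move=> x L /andP[x0 xe].
have xk : x <= half R k.+1.
  apply: le_trans xe _; rewrite -[leRHS]mulr1 ler_wpM2l ?half_ge0//.
  by rewrite mulr_ile1 ?half_ge0 ?half_le1.
have [Lk|kL] := leqP L k.
  rewrite big1// => l _; have [->|/kmin] := eqVneq (A l m) 0.
    by rewrite mul0r mulr0.
  by rewrite leqNgt (leq_trans (ltn_ord l) Lk).
rewrite (bigD1 (Ordinal kL))//=.
have rest : \sum_(i < L | i != Ordinal kL) half R i.+1 * (A i m * (x - half R i)) <= x.
  apply: (@le_trans _ _ (\sum_(i < L | i != Ordinal kL) half R i.+1 * x)).
    apply: ler_sum => l _; rewrite ler_wpM2l ?half_ge0//.
    have := A_ge0 l m; have := A_le1 l m; have := half_ge0 R l; nra.
  rewrite -mulr_suml -[leRHS]mul1r ler_wpM2r//.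
  apply: (@le_trans _ _ (\sum_(i < L) half R i.+1)); last first.
    by rewrite sum_halfS; have := half_ge0 R L; lra.
  rewrite [leRHS](bigD1 (Ordinal kL))//= lerDr half_ge0//.
apply: (@le_trans _ _ (half R k.+1 * (A k m * (x - half R k)) + x)).
  by rewrite lerD2l.
have : half R k.+1 * (A k m * (x - half R k)) <=
       half R k.+1 * (A k m * (- half R k.+1)).
  rewrite ler_wpM2l ?half_ge0// ler_wpM2l ?A_ge0//; lra.
rewrite !mulrN; lra.
Qed.

(* Finiteness of [Mem] is what gives one constant for all modes. *)
Lemma tilt : exists eta : R, [/\ 0 < eta, eta <= 1 &
  forall m L, \sum_(l < L) half R l.+1 * (A l m * (eta - half R l)) <= 0].
Proof.
have [e eP] := choice tilt_mode.
(* The default 1 ensures [eta <= 1], so that [1 - eta] is nonnegative. *)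
exists (\big[Order.min/1]_m e m); split.
- by apply: lt_bigmin => // m _; case: (eP m).
- exact: bigmin_le_id.
- move=> m L; case: (eP m) => e0 e1; apply; apply/andP; split.
    by apply: le_bigmin => // m' _; case: (eP m') => /ltW.
  exact: bigmin_le_cond.
Qed.

End Tilt.

(** * Finite-memory strategies lose almost surely *)

Section FiniteMemory.
Variables (R : realType) (Mem : finType) (T : fin_transducer (game R) Mem).
Variable sigma : strategy R state.
Hypothesis sigmaE :
  forall h s t, player (game R) s -> sigma h s t = fin_induced T h s t.

Definition mem_upd (d : Mem -> R) (s : state) : Mem -> R :=
  fun m' => \sum_m d m * pi_u T m s m'.

Definition mem_from (m : Mem) (h : seq state) : Mem -> R :=
  foldl mem_upd (fun m' => (m' == m)%:R) h.

(** The update is linear: a run from [d] is the mixture of the runs from single modes. *)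
Lemma foldl_mem_upd d h m' :
  foldl mem_upd d h m' = \sum_m d m * mem_from m h m'.
Proof.
elim/last_ind: h m' => [|h s IH] m'.
  rewrite /mem_from /= (bigD1 m')//= eqxx mulr1 big1 ?addr0// => m /negbTE mm'.
  by rewrite eq_sym mm' mulr0.
rewrite /mem_from foldl_rcons /mem_upd.
under eq_bigr do rewrite IH mulr_suml.
rewrite exchange_big; apply: eq_bigr => m _ /=.
by rewrite foldl_rcons mulr_sumr; apply: eq_bigr => k _; rewrite mulrA.
Qed.

Lemma mem_upd_dist d : (forall m, 0 <= d m) -> \sum_m d m = 1 -> forall h,
  (forall m, 0 <= foldl mem_upd d h m) /\ \sum_m foldl mem_upd d h m = 1.
Proof.
move=> d0 d1; elim/last_ind => // h s [h0 h1].
rewrite foldl_rcons; split=> [m|].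
  by apply: sumr_ge0 => k _; rewrite mulr_ge0// pi_u_ge0.
rewrite /mem_upd exchange_big /= -[RHS]h1; apply: eq_bigr => m _.
by rewrite -mulr_sumr pi_u_sum1 mulr1.
Qed.

Lemma dirac_sum1 (m : Mem) : \sum_m' (m' == m)%:R = 1 :> R.
Proof. by rewrite (bigD1 m)//= eqxx big1 ?addr0// => k /negbTE->. Qed.

Lemma fin_mem_distE h : fin_mem_dist T h = mem_from (m0 T) h.
Proof. by []. Qed.

Lemma mem_from_ge0 m h m' : 0 <= mem_from m h m'.
Proof. by apply: (mem_upd_dist _ (dirac_sum1 m) h).1. Qed.

Lemma mem_from_sum1 m h : \sum_m' mem_from m h m' = 1.
Proof. by apply: (mem_upd_dist _ (dirac_sum1 m) h).2. Qed.

Lemma mem_from_cat m h x m' :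
  mem_from m (h ++ x) m' = \sum_k mem_from m h k * mem_from k x m'.
Proof. by rewrite /mem_from foldl_cat foldl_mem_upd. Qed.

Lemma pi_s_sum m l :
  pi_s T m (Offer l) (Taken l) + pi_s T m (Offer l) (Draw 0) = 1.
Proof.
have /(_ isT) := @pi_s_sum1 _ _ _ _ T m (Offer l).
rewrite (esum_seq (succ_uniq (Offer l))) => [|t|t].
- by rewrite !big_cons big_nil addr0 => -[].
- exact: pi_s_ge0.
- by apply: contraNeq; exact: pi_s_supp.
Qed.

Lemma sigma_ge0 h l t : 0 <= sigma h (Offer l) t.
Proof.
rewrite sigmaE//; apply: sumr_ge0 => m _.
by rewrite mulr_ge0 ?pi_s_ge0// fin_mem_distE mem_from_ge0.
Qed.

Lemma sigma_supp h l t : t \notin succ (Offer l) -> sigma h (Offer l) t = 0.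
Proof.
move=> tl; rewrite sigmaE// /fin_induced big1// => m _.
have [->|/(pi_s_supp (isT : player (game R) (Offer l)))] :=
    eqVneq (pi_s T m (Offer l) t) 0; first by rewrite mulr0.
by rewrite /= (negbTE tl).
Qed.

Lemma sigma_sum1 h l :
  sigma h (Offer l) (Taken l) + sigma h (Offer l) (Draw 0) = 1.
Proof.
rewrite !sigmaE// /fin_induced -big_split /= -[RHS](mem_from_sum1 (m0 T) h).
by apply: eq_bigr => m _; rewrite -mulrDr pi_s_sum mulr1.
Qed.

Let stp_ge0 := game_step_ge0 sigma_ge0.
Let stp_supp := game_step_supp sigma_supp.
Let stp_sum1 := game_step_sum1 sigma_sum1.

(** Probability of taking level [l] when it is offered in a draw started in mode [m]. The memory has
    then read [Draw 0] to [Draw l], but not yet the offer. *)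
Definition accept l m : R :=
  \sum_k mem_from m (mkseq Draw l.+1) k * pi_s T k (Offer l) (Taken l).

Lemma sigma_accept h l : sigma (h ++ mkseq Draw l.+1) (Offer l) (Taken l) =
  \sum_m mem_from (m0 T) h m * accept l m.
Proof.
rewrite sigmaE// /fin_induced fin_mem_distE.
under eq_bigr do rewrite mem_from_cat mulr_suml.
rewrite exchange_big; apply: eq_bigr => m _ /=.
by rewrite mulr_sumr; apply: eq_bigr => k _; rewrite mulrA.
Qed.

Lemma accept_ge0 l m : 0 <= accept l m.
Proof. by apply: sumr_ge0 => k _; rewrite mulr_ge0 ?mem_from_ge0 ?pi_s_ge0. Qed.

Lemma accept_le1 l m : accept l m <= 1.
Proof.
rewrite -[leRHS](mem_from_sum1 m (mkseq Draw l.+1)); apply: ler_sum => k _.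
rewrite -[leRHS]mulr1 ler_wpM2l ?mem_from_ge0// -(pi_s_sum k l) lerDl.
exact: pi_s_ge0.
Qed.

(** By linearity the sum is the average of the sums in [tilt] under the memory distribution after
    [h]. *)
Lemma accept_tilt : exists eta : R, [/\ 0 < eta, eta <= 1 & forall h L,
  \sum_(l < L) half R l.+1 *
    (sigma (h ++ mkseq Draw l.+1) (Offer l) (Taken l) * (eta - half R l)) <= 0].
Proof.
have [eta [e0 e1 eP]] := tilt accept_ge0 accept_le1.
exists eta; split=> // h L.
under eq_bigr do rewrite sigma_accept mulr_suml mulr_sumr.
rewrite exchange_big /=; apply: sumr_le0 => m _.
under eq_bigr do rewrite -mulrA mulrCA.
by rewrite -mulr_sumr; apply: mulr_ge0_le0; [exact: mem_from_ge0|exact: eP].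
Qed.

(* Starting after [h0], [k] levels have been taken and left without meeting [Bad]. *)
Definition safe_target (h0 : seq state) k h u :=
  (k <= count is_taken (drop (size h0) h))%N &&
  ~~ has is_bad (drop (size h0) (rcons h u)).

Lemma safe_targetE h0 k x u : safe_target h0 k (h0 ++ x) u =
  (k <= count is_taken x)%N && ~~ has is_bad (rcons x u).
Proof. by rewrite /safe_target rcons_cat !drop_size_cat. Qed.

Local Notation hits h0 k := (hit (game R) sigma succ (safe_target h0 k)).

Lemma hit_bad h0 k L : forall x u, has is_bad (rcons x u) ->
  hits h0 k L (h0 ++ x) u = 0.
Proof.
elim: L => [|L IH] x u xu /=; rewrite safe_targetE xu andbF//.
by rewrite big1// => t _; rewrite rcons_cat IH ?mulr0// has_rcons xu orbT.
Qed.

(** Strong induction on [L], one whole draw at a time: a draw gains nothing, gains one level, or is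
    lost to [Bad]. Averaged over the levels, the risk of [Bad] supplies the factor [1 - eta] per
    gained level. *)
Lemma hit_safe eta h0 k : eta <= 1 -> (forall h L,
  \sum_(l < L) half R l.+1 *
    (sigma (h ++ mkseq Draw l.+1) (Offer l) (Taken l) * (eta - half R l)) <= 0) ->
  forall L x, ~~ has is_bad x ->
  hits h0 k L (h0 ++ x) (Draw 0) <= (1 - eta) ^+ (k - count is_taken x).
Proof.
move=> eta1 etaP; set rho := 1 - eta; have rho0 : 0 <= rho by rewrite subr_ge0.
elim/ltn_ind => L IH x xbad; case Eq: (k - count is_taken x)%N => [|q].
  exact: hit_le1.
have kx : (k <= count is_taken x)%N = false by rewrite -subn_eq0 Eq.
have has_draws i : has is_bad (mkseq Draw i) = false.
  by rewrite /mkseq has_map; apply/hasPn.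
have count_draws i : count is_taken (x ++ mkseq Draw i) = count is_taken x.
  by rewrite count_cat [X in (_ + X)%N](_ : _ = 0%N) ?addn0//; rewrite /mkseq; elim: iota.
pose a i := sigma ((h0 ++ x) ++ mkseq Draw i.+1) (Offer i) (Taken i).
(* Bound at [Offer i]: [q] levels remain after taking it and surviving, [q.+1] after declining. *)
pose X i := a i * (1 - half R i) * rho ^+ q + (1 - a i) * rho ^+ q.+1.
have a0 i : 0 <= a i by apply: sigma_ge0.
have a1 i : a i <= 1.
  by rewrite -(sigma_sum1 ((h0 ++ x) ++ mkseq Draw i.+1) i) lerDl sigma_ge0.
have X0 i : 0 <= X i.
  by rewrite addr_ge0// !mulr_ge0 ?exprn_ge0// subr_ge0// half_le1.
have offer i n : (n < L)%N ->
    hits h0 k n (h0 ++ (x ++ mkseq Draw i.+1)) (Offer i) <= X i.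
  case: n => [|n] nL /=; rewrite safe_targetE count_draws kx//=.
  rewrite step_sum_Offer catA -/(a i).
  have -> : sigma ((h0 ++ x) ++ mkseq Draw i.+1) (Offer i) (Draw 0) = 1 - a i.
    by rewrite -(sigma_sum1 ((h0 ++ x) ++ mkseq Draw i.+1) i) -/(a i) addrC addKr.
  rewrite -!catA rcons_cat rcons_cat; set y := x ++ rcons _ _.
  have cy : count is_taken y = count is_taken x.
    by rewrite /y -rcons_cat -cats1 count_cat count_draws /= !addn0.
  have yb : ~~ has is_bad y.
    by rewrite /y -rcons_cat has_rcons has_cat (negbTE xbad) has_draws.
  rewrite lerD//; last first.
    rewrite ler_wpM2l ?subr_ge0//; apply: le_trans (IH n _ y yb) _.
      exact: ltnW.
    by rewrite cy Eq.
  rewrite -mulrA ler_wpM2l//.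
  have B0 : 0 <= (1 - half R i) * rho ^+ q.
    by rewrite mulr_ge0 ?exprn_ge0// subr_ge0 half_le1.
  case: n nL => [|n] nL /=; rewrite safe_targetE cy kx//=.
  rewrite step_sum_Taken rcons_cat hit_bad ?has_rcons// mulr0 add0r.
  rewrite ler_wpM2l ?subr_ge0 ?half_le1//.
  apply: le_trans (IH n _ _ _) _; first by do 2!apply: ltnW.
    by rewrite has_rcons.
  by rewrite -cats1 count_cat cy /= addn0 addn1 subnS Eq.
(* From [Draw i], level [i + l] is the one offered with probability [2^-(l+1)]. *)
have draw n i : (n <= L)%N -> hits h0 k n (h0 ++ (x ++ mkseq Draw i)) (Draw i) <=
    \sum_(l < n) half R l.+1 * X (i + l)%N.
  elim: n i => [|n IHn] i nL /=; rewrite safe_targetE count_draws kx//=.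
    by rewrite big_ord0.
  rewrite step_sum_Draw !rcons_cat -mkseqS_rcons big_ord_recl addn0.
  have := offer i n nL; have := IHn i.+1 (ltnW nL).
  have -> : \sum_(l < n) half R (bump 0 l).+1 * X (i + bump 0 l)%N =
      (\sum_(l < n) half R l.+1 * X (i.+1 + l)%N) / 2.
    rewrite mulr_suml; apply: eq_bigr => l _.
    by rewrite /bump leq0n add1n [half R _.+2]halfS addSnnS mulrAC.
  have -> : half R 1 = 1 / 2 by rewrite /half expr1 mul1r.
  by lra.
have := draw L 0%N (leqnn L); rewrite cats0 => /le_trans; apply.
(* As [rho = 1 - eta], [X l] equals [rho ^+ q.+1 + a l * (eta - half R l) * rho ^+ q]. *)
have -> : \sum_(l < L) half R l.+1 * X (0 + l)%N =
    (\sum_(l < L) half R l.+1) * rho ^+ q.+1 +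
    (\sum_(l < L) half R l.+1 * (a l * (eta - half R l))) * rho ^+ q.
  rewrite !mulr_suml -big_split; apply: eq_bigr => l _ /=.
  by rewrite add0n /X exprS /rho; lra.
rewrite sum_halfS.
have := etaP (h0 ++ x) L; have := exprn_ge0 q rho0; have := exprn_ge0 q.+1 rho0.
by have := half_ge0 R L; rewrite -/(a _); nra.
Qed.

(** A winning play shows color 2 infinitely often and color 3 finitely often, so from some visit to
    [Draw 0] on it takes levels forever without meeting [Bad]. The prefixes [h0] before such visits
    are countably many, and [hit_safe] applies to each with every [k]. *)
Lemma finite_memory_null : null (game R) (Draw 0) sigma (Parity (game R) color).
Proof.
have [eta [e0 e1 etaP]] := accept_tilt.
apply: (@null_sub _ _ _ _ _ _ [set rho | exists h0 : seq state, rho (size h0) = Draw 0 /\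
  mkseq rho (size h0) = h0 /\ forall k, exists n,
    safe_target h0 k (mkseq rho (size h0 + n)) (rho (size h0 + n)%N)]).
  move=> rho [play [c [cinf [cev cmax]]]].
  have [n0 [_ cn0]] := cinf 0%N.
  have c2 : c = 2%N by move: cev; rewrite -cn0; case: (rho n0).
  have {}cmax : ~ inf_often color rho 3.
    by move=> /cmax; rewrite c2.
  have [N Nbad] : exists N, forall n, (N <= n)%N -> ~~ is_bad (rho n).
    apply: contrapT => nN; apply: cmax => N; apply: contrapT => nn.
    apply: nN; exists N => n Nn; apply/negP => bn; apply: nn; exists n; split=> //.
    by case: (rho n) bn.
  have tinf m : exists n, (m <= n)%N /\ is_taken (rho n).
    have [n [mn cn]] := cinf m; exists n; split=> //.
    by move: cn; rewrite c2; case: (rho n).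
  have [n [Nn tn]] := tinf N.
  exists (mkseq rho n.+1); rewrite size_mkseq.
  have r0 : rho n.+1 = Draw 0.
    have := play n; have := Nbad n.+1 (leqW Nn).
    case: (rho n) tn => // l _ /=; case: (rho n.+1) => //= i _.
    by rewrite !inE => /orP[] // /eqP.
  split=> //; split=> // k.
  have [j kj] : exists j, (k <= count is_taken (mkseq (fun i => rho (n.+1 + i)%N) j))%N.
    apply: (@count_mkseq_unbounded is_taken (fun i => rho (n.+1 + i)%N)) => N'.
    have [m [mn tm]] := tinf (n.+1 + N')%N; exists (m - n.+1)%N.
    by rewrite leq_subRL ?(leq_trans _ mn) ?leq_addr// subnKC ?(leq_trans _ mn) ?leq_addr.
  exists j; rewrite /safe_target size_mkseq drop_mkseq kj andTb.
  rewrite -mkseqS_rcons -addnS drop_mkseq /mkseq has_map; apply/hasPn => i _ /=.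
  by apply: Nbad; rewrite (leq_trans Nn)// leqW// leq_addr.
have ds : Bad != Draw 0 by [].
apply: (null_ex ds stp_ge0) => h0.
apply: (null_hit ds succ_uniq stp_ge0 stp_supp stp_sum1 (h:=h0) (u:=Draw 0)).
move=> e epos.
have [k rk] : exists k, (1 - eta) ^+ k <= e.
  by apply: exists_expr_le => //; apply/andP; split; lra.
exists (safe_target h0 k); split=> [L|rho [r0 [rh rk']]].
  apply: le_trans rk; have := hit_safe h0 k e1 etaP L (isT : ~~ has is_bad [::]).
  by rewrite cats0 subn0.
by split; [rewrite mkseqS_rcons rh r0|exact: rk'].
Qed.

End FiniteMemory.

(** * The threshold strategy, whose mode is the number of levels taken *)

Section InfiniteMemory.
Variable R : realType.

Lemma threshold_edge (n : nat) (s : state) : player (game R) s ->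
  edge (game R) s (if s is Offer l then if (n <= l)%N then Taken l else Draw 0 else s).
Proof. by case: s => // l _; case: ifP => _ /=; rewrite !inE eqxx ?orbT. Qed.

Definition threshold_transducer : det_transducer (game R) nat :=
  DetTransducer 0%N (fun n s => n + is_taken s)%N threshold_edge.

Definition threshold := det_induced threshold_transducer.

Local Notation ntaken := (count is_taken).
Local Notation stp := (step (game R) threshold).

Lemma memory_ntaken h n : foldl (fun n s => n + is_taken s)%N n h = (n + ntaken h)%N.
Proof. by elim: h n => [|s h IH] n /=; rewrite ?addn0// IH addnA. Qed.

Lemma ntaken_rcons h u : ntaken (rcons h u) = (ntaken h + is_taken u)%N.
Proof. by rewrite -cats1 count_cat /= addn0. Qed.

Lemma threshold_Offer h l t : threshold h (Offer l) t =
  (t == if (ntaken h <= l)%N then Taken l else Draw 0)%:R.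
Proof. by rewrite /threshold /det_induced /= memory_ntaken. Qed.

Lemma threshold_ge0 h l t : 0 <= threshold h (Offer l) t.
Proof. by rewrite threshold_Offer ler0n. Qed.

Lemma threshold_supp h l t : t \notin succ (Offer l) -> threshold h (Offer l) t = 0.
Proof.
rewrite threshold_Offer !inE negb_or => /andP[/negbTE t1 /negbTE t2].
by case: ifP; rewrite ?t1 ?t2.
Qed.

Lemma threshold_sum1 h l :
  threshold h (Offer l) (Taken l) + threshold h (Offer l) (Draw 0) = 1.
Proof. by rewrite !threshold_Offer; case: ifP => _; rewrite eqxx /= ?addr0 ?add0r. Qed.

Let stp_ge0 := game_step_ge0 threshold_ge0.
Let stp_supp := game_step_supp threshold_supp.
Let stp_sum1 := game_step_sum1 threshold_sum1.

Lemma threshold_sum_Offer h l f :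
  \sum_(t <- succ (Offer l)) stp h (Offer l) t * f t =
  if (ntaken h <= l)%N then f (Taken l) else f (Draw 0).
Proof.
by rewrite step_sum_Offer !threshold_Offer; case: ifP => _;
  rewrite eqxx /= !mul0r mul1r ?addr0 ?add0r.
Qed.

Let start_neq : Bad != Draw 0. Proof. by []. Qed.

(** * Waiting for the next taken level *)

Section Stuck.
Variables (n N H : nat).
Hypothesis H_gt0 : (0 < H)%N.

Definition pow2 : R := 2 ^+ n.

(* Bound on the expected time until the next acceptance. *)
Definition wait (u : state) : R :=
  match u with
  | Draw i => 3 * pow2 + 3 - 3 * 2 ^+ minn i n
  | Offer i => if (i < n)%N then 3 * pow2 + 1 else 1
  | Taken _ => 3 * pow2 + 2
  | Bad => 3 * pow2 + 1
  end.

Lemma pow2_ge1 : 1 <= pow2.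
Proof. by rewrite exprn_ege1// ler1n. Qed.

Lemma wait_ge0 u : 0 <= wait u.
Proof.
have p1 := pow2_ge1; case: u => [i|i|i|] /=; try (case: ifP => _); try lra.
suff : 2 ^+ minn i n <= pow2 by lra.
by rewrite ler_weXn2l ?geq_minr// ler1n.
Qed.

Definition stuck_target (h : seq state) (u : state) :=
  (size h == N + H)%N && (ntaken (rcons h u) == n).

(** Markov bound for waiting [H] steps from time [N] on: elapsed time plus expected remaining time,
    over [H]. *)
Definition stuck_pot (h : seq state) (u : state) : R :=
  if ntaken (rcons h u) == n then (wait u + (size h - N)%:R) / H%:R else 0.

(** Each step adds at most 1 to the elapsed time and lowers [wait] by at least 1 on average, with 0
    as remaining time once a further level is taken. *)
Lemma hit_stuck L h u : (n <= ntaken (rcons h u))%N ->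
  hit (game R) threshold succ stuck_target L h u <= stuck_pot h u.
Proof.
have Hp : 0 < H%:R :> R by rewrite ltr0n.
apply: (hit_le stp_ge0 (I := fun h u => n <= ntaken (rcons h u))%N) => {L h u}.
- by move=> h u t nu _; rewrite ntaken_rcons (leq_trans nu)// leq_addr.
- move=> h u; rewrite /stuck_pot; case: ifP => // _.
  by rewrite divr_ge0 ?ler0n// addr_ge0 ?wait_ge0.
- move=> h u /andP[/eqP hN cn]; rewrite /stuck_pot ifT//.
  by rewrite hN addKn ler_pdivlMr// mul1r lerDr wait_ge0.
move=> h u nu _; have [un|un] := eqVneq (ntaken (rcons h u)) n; last first.
  have nlt : (n < ntaken (rcons h u))%N by rewrite ltn_neqAle eq_sym un.
  rewrite /stuck_pot (negbTE un) big1// => t _.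
  by rewrite [ntaken (rcons _ t)]ntaken_rcons gtn_eqF ?mulr0// (leq_trans nlt)// leq_addr.
pose s : R := (size h - N)%:R; have s0 : 0 <= s by rewrite ler0n.
pose g t : R := if is_taken t then 0 else wait t + (s + 1).
have spot t : stuck_pot (rcons h u) t <= g t / H%:R.
  rewrite /stuck_pot /g ntaken_rcons un; case: (is_taken t).
    by rewrite addn1 gtn_eqF// mul0r.
  rewrite addn0 eqxx ler_pM2r ?invr_gt0// lerD2l size_rcons /s natr1 ler_nat.
  by rewrite leq_subLR addnS ltnS -leq_subLR.
apply: (@le_trans _ _ ((\sum_(t <- succ u) stp h u t * g t) / H%:R)).
  rewrite mulr_suml; apply: ler_sum => t _.
  by rewrite -mulrA ler_wpM2l// stp_ge0.
rewrite /stuck_pot un eqxx ler_pM2r ?invr_gt0// -/s {spot}.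
have p1 := pow2_ge1; rewrite ntaken_rcons in un.
case: u nu un => [i|i|i|] nu un.
- rewrite step_sum_Draw /g /=; case: ltnP => ni.
    by rewrite (minn_idPl ni) exprS; lra.
  by rewrite (minn_idPr (leqW ni)) -/pow2; lra.
- rewrite threshold_sum_Offer; move: un; rewrite addn0 => ->.
  by rewrite /g /= min0n expr0; case: leqP => _; lra.
- rewrite step_sum_Taken /g /= min0n expr0.
  by have := half_le1 R i; have := half_ge0 R i; nra.
- by rewrite step_sum_Bad /g /= min0n expr0; lra.
Qed.
End Stuck.

Lemma stuck_null h u : null (game R) (Draw 0) threshold
  [set rho | mkseq rho (size h).+1 = rcons h u /\
    forall m, (size h <= m)%N -> ntaken (mkseq rho m.+1) = ntaken (rcons h u)].
Proof.
apply: (null_hit start_neq succ_uniq stp_ge0 stp_supp stp_sum1 (h:=h) (u:=u)).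
move=> e e0; set n := ntaken (rcons h u).
(* [H] exceeds [wait n u / e], so the Markov bound at time [size h] is at most [e]. *)
pose H := (Num.truncn (wait n u / e)).+1.
exists (stuck_target n (size h) H); split=> [L|rho [rh st]].
  apply: le_trans (hit_stuck _ _ _ (leqnn _)) _ => //.
  rewrite /stuck_pot eqxx subnn addr0 ler_pdivrMr ?ltr0n// mulrC -ler_pdivrMr//.
  by apply/ltW/truncnS_gt.
split=> //; exists H; rewrite /stuck_target size_mkseq eqxx -mkseqS_rcons.
by rewrite st ?leq_addr//=.
Qed.

(** * Failures after many taken levels *)

Section Bad.
Variable n : nat.

Definition bad_target (h : seq state) (u : state) := is_bad u && (n < ntaken h)%N.

(** Union bound: the sum of [2^-j] over all [j >= maxn n (ntaken h)]. A trial in progress at [u] is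
    still to be decided, hence [h] and not [rcons h u]. *)
Definition bad_pot (h : seq state) (u : state) : R :=
  if bad_target h u then 1 else 2 * half R (maxn n (ntaken h)).

(* The invariant says that the level being tried is at least the number of earlier
   acceptances, so the [j]-th trial fails with probability at most [2^-j]. *)
Lemma hit_bad_after L :
  hit (game R) threshold succ bad_target L [::] (Draw 0) <= 2 * half R n.
Proof.
have -> : 2 * half R n = bad_pot [::] (Draw 0) by rewrite /bad_pot /= maxn0.
apply: (hit_le stp_ge0
  (I := fun h u => if u is Taken l then ntaken h <= l else true)%N) => // {L}.
- move=> h u [//|//|l|//] _ st.
  case: u st => [i|i|i|] st; try by move: st; rewrite stp_supp ?eqxx.
  have {st} : threshold h (Offer i) (Taken l) != 0 := st.
  rewrite threshold_Offer ntaken_rcons addn0.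
  case: ifP => hi; case: (Taken l =P _) => [tl|_]; rewrite ?eqxx // => _.
  have [->] : Taken l = Taken i := tl.
  exact: hi.
- move=> h u; rewrite /bad_pot; case: ifP => // _.
  by rewrite mulr_ge0 ?half_ge0.
- by move=> h u; rewrite /bad_pot => ->.
move=> h u; case: u => [i|i|i|] Ih nT; rewrite {2}/bad_pot (negbTE nT).
- rewrite step_sum_Draw /bad_pot /= ntaken_rcons /= !addn0; lra.
- rewrite threshold_sum_Offer /bad_pot /= ntaken_rcons /= !addn0 if_same; lra.
- rewrite step_sum_Taken /bad_pot /bad_target /= ntaken_rcons /= addn1.
  have h0 := half_ge0 R i; have h1 := half_le1 R i.
  have hi := half_le R Ih.
  (* Failing hits the target only if [n <= ntaken h]. With [j = ntaken h] the potential then falls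
     from [2 * 2^-j] to [2^-j] on survival, which pays for a failure of probability at most
     [2^-j]. *)
  case: ltnP => nj.
    rewrite (maxn_idPr (_ : n <= ntaken h)%N)// halfS.
    have := half_ge0 R (ntaken h); nra.
  by rewrite (maxn_idPl (ltnW nj)); lra.
- rewrite step_sum_Bad /bad_pot /= ntaken_rcons /= !addn0; lra.
Qed.
End Bad.

Lemma bad_null : null (game R) (Draw 0) threshold
  [set rho | rho 0%N = Draw 0 /\
    forall n, exists m, (n < ntaken (mkseq rho m))%N /\ is_bad (rho m)].
Proof.
apply: (null_hit start_neq succ_uniq stp_ge0 stp_supp stp_sum1 (h:=[::]) (u:=Draw 0)).
move=> e e0.
have [n ne] : exists n, half R n <= e / 2.
  by apply: exists_expr_le; [apply/andP; split; lra|rewrite divr_gt0].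
exists (bad_target n); split=> [L|rho [r0 st]].
  apply: le_trans (hit_bad_after n L) _; lra.
split; first by rewrite mkseqS_rcons r0.
by have [m [nm bm]] := st n; exists m; rewrite /bad_target bm.
Qed.

(** A sequence outside the parity set has a wrong start or a step of probability 0, or takes no
    level from some time on, or meets [Bad] after arbitrarily many levels. Each case is null, the
    second as a countable union over prefixes. *)
Lemma threshold_wins : null (game R) (Draw 0) threshold (~` Parity (game R) color).
Proof.
apply: (null_sub (B := [set rho | ~ (rho 0%N = Draw 0 /\
    forall n, stp (mkseq rho n) (rho n) (rho n.+1) != 0)] `|`
  ([set rho | exists hu : seq state * state,
    mkseq rho (size hu.1).+1 = rcons hu.1 hu.2 /\
    forall m, (size hu.1 <= m)%N ->
      ntaken (mkseq rho m.+1) = ntaken (rcons hu.1 hu.2)] `|`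
  [set rho | rho 0%N = Draw 0 /\
    forall n, exists m, (n < ntaken (mkseq rho m))%N /\ is_bad (rho m)]))); last first.
  apply: (null_setU start_neq stp_ge0).
    exact: (null_step0 start_neq stp_ge0).
  apply: (null_setU start_neq stp_ge0); last exact: bad_null.
  by apply: (null_ex start_neq stp_ge0) => -[h u]; exact: stuck_null.
move=> rho notP.
have [[r0 st]|nst] := pselect (rho 0%N = Draw 0 /\
  forall n, stp (mkseq rho n) (rho n) (rho n.+1) != 0); last by left.
have [tinf|tfin] := pselect (forall N, exists n, (N <= n)%N /\ is_taken (rho n)).
- right; right; split=> // n; apply: contrapT => nbad; apply: notP; split.
    move=> i; apply: contrapT => /negP ne; have := st i.
    by rewrite stp_supp ?eqxx.
  (* From time [m0] on more than [n] levels have been taken, so [Bad] no longer occurs and color 3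
     does not recur. *)
  have [m0 nm0] := count_mkseq_unbounded tinf n.+1.
  exists 2%N; split=> [N|]; last split=> // c cinf.
    by have [m [Nm tm]] := tinf N; exists m; split=> //; case: (rho m) tm.
  have [m [m0m <-]] := cinf m0.
  have : ~~ is_bad (rho m).
    apply/negP => bm; apply: nbad; exists m; split=> //.
    by rewrite (leq_trans nm0)// /mkseq -(subnKC m0m) iotaD map_cat count_cat leq_addr.
  by case: (rho m).
- right; left; have [N tN] : exists N, forall n, (N <= n)%N -> ~~ is_taken (rho n).
    apply: contrapT => nN; apply: tfin => N; apply: contrapT => nn.
    apply: nN; exists N => n Nn; apply/negP => tn; apply: nn; by exists n.
  exists (mkseq rho N, rho N); cbn [fst snd]; rewrite size_mkseq -mkseqS_rcons.
  split=> // m Nm.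
  elim: m Nm => [|m IH]; first by rewrite leqn0 => /eqP ->.
  rewrite leq_eqVlt => /predU1P[->//|Nm].
  by rewrite (mkseqS_rcons rho m.+1) ntaken_rcons (negbTE (tN _ (ltnW Nm))) addn0 IH.
Qed.

End InfiniteMemory.

Theorem theorem1 (R : realType) :
  exists (S : countType) (M : mdp R S) (Col : S -> nat) (s0 : S),
    finitely_branching M /\
    (forall s, (1 <= Col s <= 3)%N) /\
    (forall sigma : strategy R S, FR_strategy M sigma ->
       Prob M s0 sigma (Parity M Col) = 0%E) /\
    (exists sigma : strategy R S, HD_strategy M sigma /\
       Prob M s0 sigma (Parity M Col) = 1%E).
Proof.
exists state, (game R), color, (Draw 0).
have start_neq : Bad != Draw 0 by [].
split; first exact: game_finitely_branching.
split; first by case.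
split=> [sigma [Mem [T sigmaE]]|].
  have sigma0 := game_step_ge0 (sigma_ge0 sigmaE).
  by apply: (Prob_null sigma0); exact: (finite_memory_null sigmaE).
exists (threshold R); split; first by exists nat, (threshold_transducer R).
have step0 := game_step_ge0 (@threshold_ge0 R).
have step_supp := game_step_supp (@threshold_supp R).
have step_sum1 := game_step_sum1 (@threshold_sum1 R).
exact: (Prob_full start_neq succ_uniq step0 step_supp step_sum1 (@threshold_wins R)).
Qed.
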